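(* Let $\beta\in(0,1)$ and let $f$ be the $2$-additive function defined by $f(2^j)=\beta^j$ for $j\geqslant0$, i.e. $f(n)=\sum_{j\geqslant0}\delta_j(n)\beta^j$ where $n=\sum_{j\geqslant 0}\delta_j(n)2^j$ with $\delta_j(n)\in\{0,1\}$ is the binary expansion of $n$. Let $F_N(y)=\frac1N\#\{n<N: f(n)\leqslant y\}$ and let $F(y)=\lim_{N\to\infty}F_N(y)$ be the limiting distribution function. Then there exists an exponent $c(\beta)>0$ such that \[ \|F-F_N\|_\infty\ll_\beta N^{-c(\beta)}(\log N)^{\log(1/\beta)/\log 2}, \] where the implicit constant depends on $\beta$. Moreover, if $F$ is absolutely continuous, then \[ \|F-F_N\|_\infty\ll_\beta N^{-\log(1/\beta)/(\log 2+\log(2/\beta))}(\log N)^{\log(1/\beta)/\log 2}. \]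
   Context: $\|\cdot\|_\infty$ denotes the sup norm over $y\in\mathbb{R}$. *)

(* Defs.v *)
From mathcomp Require Import all_boot all_order all_algebra.
From mathcomp Require Import all_classical all_reals all_analysis.
Set Implicit Arguments.
Unset Strict Implicit.
Unset Printing Implicit Defensive.
Import Order.TTheory GRing.Theory Num.Theory.
Import numFieldNormedType.Exports.
Local Open Scope classical_set_scope.
Local Open Scope ring_scope.

Definition binary_digit (n j : nat) : nat := ((n %/ 2 ^ j) %% 2)%N.

(* The sum over all j >= 0 is truncated at j < n: since n < 2 ^ n, the binary
   digits of n of index j >= n are all 0. *)
Definition additive_fun (R : realType) (beta : R) (n : nat) : R :=
  \sum_(j < n) (binary_digit n j)%:R * beta ^+ j.

Definition empirical_df (R : realType) (beta : R) (N : nat) (y : R) : R :=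
  #|[pred n : 'I_N | additive_fun beta n <= y]|%:R / N%:R.

(* [limn] has an unspecified value at a y where the sequence diverges; a bound
   on the sup norm of [limit_df beta - empirical_df beta N] that tends to 0
   forces convergence at every y, so such values play no role. *)
Definition limit_df (R : realType) (beta : R) (y : R) : R :=
  limn (fun N : nat => empirical_df beta N y).

(* A genuine supremum over all real y (not an essential supremum), which is
   +oo when g is unbounded. *)
Definition sup_norm (R : realType) (g : R -> R) : \bar R :=
  ereal_sup (range (fun y : R => `|g y|%:E)).

(* Absolute continuity on the whole real line (with a uniform delta), not only
   on each compact interval. *)
Definition absolutely_continuous (R : realType) (G : R -> R) : Prop :=
  forall eps : R, 0 < eps -> exists2 delta : R, 0 < delta &
    forall (m : nat) (a b : 'I_m -> R),
      (forall i, a i <= b i) ->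
      trivIset setT (fun i : 'I_m => `]a i, b i[%classic) ->
      \sum_(i < m) (b i - a i) < delta ->
      \sum_(i < m) `|G (b i) - G (a i)| < eps.

(* Main.v *)
Require Import Defs.
From mathcomp Require Import all_boot all_order all_algebra.
From mathcomp Require Import all_classical all_reals all_analysis.
From mathcomp Require Import zify ring lra.
Import Order.TTheory GRing.Theory Num.Theory.
Import numFieldNormedType.Exports.
Local Open Scope classical_set_scope.
Local Open Scope ring_scope.

(* Since f(r + 2^k b) = f(r) + beta^k f(b) for r < 2^k, and 0 <= f < L = 1/(1 - beta),
   each full dyadic block of length 2^k contains a proportion of values <= y lying
   between F_{2^k}(y - L beta^k) and F_{2^k}(y).  Choose m with g = beta^m <= 1/2.
   For r < 2^(m q), fix all binary digits except those of index divisible by m: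
   what remains are 2^q values that are g^q-separated, so a window of length
   L beta^(m q) contains O(2^(m q - q)) of the f(r).  Hence
   |F_N - F_{2^(m q)}| << 2^-q + 2^(m q) / N, and 2^((m + 1) q) ~ N gives
   |F - F_N| << N^(-1/(m + 1)).  If beta >= 1/2, then m can be chosen with
   1/4 <= beta^m <= 1/2, and 1/(m + 1) is at least the claimed exponent.  If
   beta < 1/2, then F is not absolutely continuous: it increases by 1 over 2^k disjoint
   intervals of length L beta^k.  The powers
   of log N in the statement only weaken these bounds, log N being bounded below. *)

(** * Binary digits and the range of [additive_fun] *)

Lemma sum_nat_mul (V : nmodType) (a b : nat) (G : nat -> V) :
  \sum_(0 <= n < a * b) G n = \sum_(0 <= j < b) \sum_(0 <= i < a) G (i + a * j)%N.
Proof.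
elim: b => [|b IH]; first by rewrite muln0 !big_geq.
rewrite mulnS addnC (big_cat_nat (n := (a * b)%N)) ?leq_addr //= IH big_nat_recr //=.
by congr (_ + _); rewrite -{1}[(a * b)%N]add0n big_addn addKn.
Qed.

Lemma additive_fun_trunc (R : realType) (beta : R) (K n : nat) :
  (n < 2 ^ K)%N ->
  additive_fun beta n = \sum_(j < K) (binary_digit n j)%:R * beta ^+ j.
Proof.
have digit0 i L : (n < 2 ^ L)%N -> (L <= i)%N -> (binary_digit n i)%:R * beta ^+ i = 0.
  move=> nL Li; rewrite /binary_digit divn_small ?mod0n ?mul0r //.
  by apply: leq_trans nL _; rewrite leq_exp2l.
have nn : (n < 2 ^ n)%N by apply: ltn_expl.
move=> nK; rewrite /additive_fun.
rewrite -!(big_mkord xpredT (fun j => (binary_digit n j)%:R * beta ^+ j)).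
have [le|/ltnW le] := leqP n K.
  rewrite [RHS](big_cat_nat (n := n)) //= [X in _ + X]big_nat_cond.
  by rewrite [X in _ + X]big1 ?addr0 // => i /andP[/andP[ni _] _]; apply: digit0 ni.
rewrite (big_cat_nat (n := K)) //= [X in _ + X]big_nat_cond.
by rewrite [X in _ + X]big1 ?addr0 // => i /andP[/andP[ni _] _]; apply: digit0 ni.
Qed.

Lemma additive_fun_bit (R : realType) (beta : R) (e b : nat) :
  (e < 2)%N -> additive_fun beta (e + 2 * b) = e%:R + beta * additive_fun beta b.
Proof.
move=> e2.
have bb : (b < 2 ^ b)%N by apply: ltn_expl.
rewrite (@additive_fun_trunc _ _ b.+1); last by rewrite expnS; lia.
rewrite big_ord_recl /binary_digit expn0 divn1 expr0 mulr1 -modnDmr modnMr addn0 modn_small //.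
congr (_ + _); rewrite /additive_fun mulr_sumr; apply: eq_bigr => j _.
rewrite lift0 expnS divnMA.
by rewrite [(e + _)%N]addnC mulnC divnMDl // (divn_small e2) addn0 exprS mulrCA.
Qed.

Lemma additive_fun0 (R : realType) (beta : R) : additive_fun beta 0 = 0.
Proof. by rewrite /additive_fun big_ord0. Qed.

Lemma additive_fun_block (R : realType) (beta : R) (k r b : nat) : (r < 2 ^ k)%N ->
  additive_fun beta (r + 2 ^ k * b) = additive_fun beta r + beta ^+ k * additive_fun beta b.
Proof.
elim: k r b => [|k IH] r b.
  by rewrite expn0 ltnS leqn0 => /eqP ->; rewrite add0n mul1n additive_fun0 add0r mul1r.
move=> rk; rewrite (divn_eq r 2) [in RHS]addnC ![(_ * 2)%N]mulnC.
have r2 : (r %% 2 < 2)%N by rewrite ltn_mod.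
have -> : (2 * (r %/ 2) + r %% 2 + 2 ^ k.+1 * b = r %% 2 + 2 * (r %/ 2 + 2 ^ k * b))%N.
  by rewrite expnS; lia.
rewrite !additive_fun_bit // IH; last by rewrite expnS in rk; lia.
by rewrite mulrDr addrA exprS mulrA.
Qed.

Section Range.
Context (R : realType) (beta : R).
Hypotheses (beta0 : 0 <= beta) (beta1 : beta < 1).

Lemma additive_fun_ge0 n : 0 <= additive_fun beta n.
Proof. by rewrite sumr_ge0 // => i _; rewrite mulr_ge0 ?exprn_ge0. Qed.

(** The extreme case has all [k] digits equal to 1, a geometric sum; the factor [1 - beta] stays on
    the left to avoid division in the induction. *)
Lemma additive_fun_le k n : (n < 2 ^ k)%N -> (1 - beta) * additive_fun beta n <= 1 - beta ^+ k.
Proof.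
elim: k n => [|k IH] n.
  by rewrite expn0 ltnS leqn0 => /eqP ->; rewrite additive_fun0 expr0 mulr0 subrr.
move=> nk; rewrite (divn_eq n 2) addnC mulnC additive_fun_bit ?ltn_mod //.
have /IH le : (n %/ 2 < 2 ^ k)%N by rewrite expnS in nk; lia.
have e1 : (n %% 2)%:R <= 1 :> R by rewrite lern1; lia.
rewrite mulrDr mulrCA exprS.
have : (1 - beta) * (n %% 2)%:R <= 1 - beta by rewrite ler_piMr // subr_ge0 ltW.
have : beta * ((1 - beta) * additive_fun beta (n %/ 2)) <= beta * (1 - beta ^+ k).
  exact: ler_wpM2l.
lra.
Qed.

Lemma additive_fun_lt n : 0 < beta -> additive_fun beta n < (1 - beta)^-1.
Proof.
move=> bp; rewrite -[X in _ < X]mul1r ltr_pdivlMr ?subr_gt0 // mulrC.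
apply: le_lt_trans (additive_fun_le _ _ (ltn_expl n (isT : 1 < 2)%N)) _.
by rewrite gtrBl exprn_gt0.
Qed.

End Range.

(** * Separation of values and counting in short windows *)

Lemma additive_fun_gap (R : realType) (g : R) (q r s : nat) :
  0 <= g -> g <= 2^-1 -> (r < 2 ^ q)%N -> (s < 2 ^ q)%N -> r <> s ->
  g ^+ q <= (1 - g) * `|additive_fun g r - additive_fun g s|.
Proof.
move=> g0 g2; have g1 : g < 1 by apply: le_lt_trans g2 _; rewrite invf_lt1 ?ltr1n.
elim: q r s => [|q IH] r s; first by rewrite expn0; lia.
(* By symmetry, if the lowest digits differ, [r] has the digit 1. *)
wlog : r s / (s %% 2 <= r %% 2)%N.
  move=> wl rq sq rs; have [le|/ltnW le] := leqP (s %% 2) (r %% 2); first exact: wl.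
  by rewrite distrC; apply: wl => //; apply/nesym.
rewrite expnS => le rq sq rs; rewrite (divn_eq r 2) (divn_eq s 2) ![(_ * 2 + _)%N]addnC ![(_ * 2)%N]mulnC.
rewrite !additive_fun_bit ?ltn_mod // exprS.
have rq' : (r %/ 2 < 2 ^ q)%N by lia.
have sq' : (s %/ 2 < 2 ^ q)%N by lia.
have [eqm|neqm] := eqVneq (s %% 2)%N (r %% 2)%N.
  rewrite eqm opprD addrACA subrr add0r -mulrBr normrM ger0_norm // mulrCA ler_wpM2l //.
  by apply: IH => //; lia.
(* The lowest digit outweighs the rest: the difference times [1 - g] is at least
   [(1 - g) - g * (1 - g ^+ q)], which is [(1 - 2 * g) + g ^+ q.+1]. *)
have [-> ->] : (s %% 2 = 0)%N /\ (r %% 2 = 1)%N by lia.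
apply: le_trans (ler_wpM2l _ (ler_norm _)); last by rewrite subr_ge0 ltW.
have := additive_fun_le _ _ g0 g1 _ _ sq'.
have := mulr_ge0 g0 (additive_fun_ge0 _ _ g0 (r %/ 2)).
move: (additive_fun g (r %/ 2)) (additive_fun g (s %/ 2)) (g ^+ q) => fr fs gq r0 s1.
have : g * ((1 - g) * fs) <= g * (1 - gq) by exact: ler_wpM2l.
have : 0 <= (1 - g) * (g * fr) by apply: mulr_ge0; rewrite // subr_ge0 ltW.
lra.
Qed.
(** Digits of index divisible by [m] are free and form an expansion in base value [beta ^+ m]; each
    choice of the other [m.-1 * q] digits only translates it. Arbitrary [phi] and all shifts [t] let
    the induction absorb the digits already read. *)
Lemma interleaved_count_le (R : realType) (beta : R) (m q K : nat) (phi : R -> nat) :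
  (0 < m)%N ->
  (forall t, \sum_(0 <= e < 2 ^ q) phi (t + additive_fun (beta ^+ m) e)%R <= K)%N ->
  (\sum_(0 <= r < 2 ^ (m * q)) phi (additive_fun beta r) <= K * 2 ^ (m.-1 * q))%N.
Proof.
move=> m0; elim: q phi => [|q IH] phi hphi.
  have := hphi 0; rewrite !muln0 expn0 !big_nat1 !additive_fun0 addr0 muln1.
  by [].
(* The lowest [m] digits of [r] are a free digit [e] followed by the fixed digits [c]; [phi' c] sums
   over [e] and inherits the bound [K]. *)
pose phi' c x := (\sum_(0 <= e < 2) phi (e%:R + beta * additive_fun beta c + beta ^+ m * x)%R)%N.
have -> : (\sum_(0 <= r < 2 ^ (m * q.+1)) phi (additive_fun beta r) =
  \sum_(0 <= c < 2 ^ m.-1) \sum_(0 <= r < 2 ^ (m * q)) phi' c (additive_fun beta r))%N.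
  rewrite mulnS expnD sum_nat_mul exchange_big_nat /=.
  rewrite -{1}(prednK m0) expnS sum_nat_mul; apply: eq_big_nat => c /andP[_ cm].
  rewrite exchange_big_nat /=; apply: eq_bigr => j _.
  apply: eq_big_nat => e /andP[_ e2]; congr phi.
  by rewrite additive_fun_block ?additive_fun_bit // -(prednK m0) expnS; lia.
apply: leq_trans (_ : (\sum_(0 <= c < 2 ^ m.-1) K * 2 ^ (m.-1 * q) <= _)%N).
  apply: leq_sum => c _; apply: IH => t.
  have := hphi (beta * additive_fun beta c + beta ^+ m * t).
  rewrite expnS sum_nat_mul; apply: leq_trans; rewrite leq_eqVlt; apply/orP; left.
  apply/eqP/eq_bigr => j _; apply: eq_big_nat => e /andP[_ e2]; congr phi.
  by rewrite additive_fun_bit //; ring.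
by rewrite sum_nat_const_nat subn0 mulnS expnD mulnCA.
Qed.

(** Divided by [g ^+ q], the points in the window lie in [[0, h]] at mutual distance at least 1, so
    their integer parts are distinct. *)
Lemma separated_count_le (R : realType) (g t y h : R) (q : nat) :
  0 < g -> g <= 2^-1 -> 0 <= h ->
  (\sum_(0 <= e < 2 ^ q)
     ((y < t + additive_fun g e) && (t + additive_fun g e <= y + h * g ^+ q))%R
   <= (Num.truncn h).+1)%N.
Proof.
move=> g0 g2 h0; have gq0 : 0 < g ^+ q by rewrite exprn_gt0.
have g1 : g < 1 by apply: le_lt_trans g2 _; rewrite invf_lt1 ?ltr1n.
pose P e := (y < t + additive_fun g e) && (t + additive_fun g e <= y + h * g ^+ q).
pose u e := (t + additive_fun g e - y) / g ^+ q.
have uP e : P e -> 0 <= u e <= h.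
  move=> /andP[ye ey]; apply/andP; split.
    by rewrite divr_ge0 ?subr_ge0 //; apply: ltW.
  by rewrite ler_pdivrMr // lerBlDl.
rewrite big_mkord (eq_bigr (fun i : 'I__ => if P i then 1%N else 0%N)); last first.
  by move=> i _; rewrite -/(P i); case: (P i).
rewrite -big_mkcond sum1_card /= -[leqRHS]card_ord.
apply: (@leq_card_in _ _ (fun i : 'I_(2 ^ q) => inord (Num.truncn (u i)))).
move=> i j Pi Pj /(congr1 val); have /andP[ui0 uih] := uP _ Pi.
have /andP[uj0 ujh] := uP _ Pj.
rewrite /= !inordK ?ltnS; try exact: le_truncn.
move=> ij; apply/val_inj/eqP/negPn/negP => /eqP nij.
have := additive_fun_gap _ _ _ _ _ (ltW g0) g2 (ltn_ord i) (ltn_ord j) nij.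
have : (1 - g) * `|additive_fun g i - additive_fun g j| <= `|additive_fun g i - additive_fun g j|.
  by rewrite ler_piMl // lerBlDr lerDl ltW.
have -> : additive_fun g i - additive_fun g j = (u i - u j) * g ^+ q.
  by rewrite /u; field; rewrite gt_eqF.
rewrite normrM (gtr0_norm gq0) => le1 le2; have := le_trans le2 le1.
rewrite ler_pMl // leNgt => /negP; apply.
have := truncn_itv ui0; have := truncn_itv uj0; rewrite -ij -natr1 ltr_norml.
lra.
Qed.

(** * Comparison of [empirical_df] at [N] and at a power of two *)

Lemma leq_bool (b c : bool) : (b -> c) -> (b <= c)%N.
Proof. by case: b c => [] [] // /(_ isT). Qed.

(** The numerator of [empirical_df], as a sum over an interval of [nat] so that [sum_nat_mul] can
    cut it into blocks. *)
Definition df_count {R : realType} (beta : R) (N : nat) (y : R) : nat :=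
  (\sum_(0 <= n < N) (additive_fun beta n <= y)%R)%N.

Lemma empirical_dfE (R : realType) (beta : R) N y :
  empirical_df beta N y = (df_count beta N y)%:R / N%:R.
Proof.
rewrite /empirical_df /df_count big_mkord; congr (_%:R / _).
rewrite -sum1_card big_mkcond /=; apply: eq_bigr => i _.
by rewrite unfold_in /=; case: ifP.
Qed.

Lemma df_count_le (R : realType) (beta : R) N y : (df_count beta N y <= N)%N.
Proof.
rewrite /df_count big_mkord -[leqRHS]card_ord -sum1_card.
by apply: leq_sum => i _; case: (_ <= _)%R.
Qed.

Section Blocks.
Context (R : realType) (beta : R).
Hypotheses (beta0 : 0 < beta) (beta1 : beta < 1).
Local Notation L := ((1 - beta)^-1).

Lemma df_count_blocks (k N : nat) (y : R) :
  ((N %/ 2 ^ k) * df_count beta (2 ^ k) (y - L * beta ^+ k) <= df_count beta N y)%N /\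
  (df_count beta N y <= (N %/ 2 ^ k) * df_count beta (2 ^ k) y + 2 ^ k)%N.
Proof.
pose B := (N %/ 2 ^ k)%N; have bk : 0 < beta ^+ k by rewrite exprn_gt0.
have le : (2 ^ k * B <= N)%N by rewrite mulnC leq_divM.
have blocks : (\sum_(0 <= n < 2 ^ k * B) (additive_fun beta n <= y)%R =
  \sum_(0 <= j < B) \sum_(0 <= i < 2 ^ k)
    (additive_fun beta i + beta ^+ k * additive_fun beta j <= y)%R)%N.
  rewrite sum_nat_mul; apply: eq_bigr => j _; apply: eq_big_nat => i /andP[_ ik].
  by rewrite additive_fun_block.
have const n : (\sum_(0 <= j < B) n = B * n)%N by rewrite sum_nat_const_nat subn0.
rewrite /df_count -/B (big_cat_nat (leq0n _) le) /= blocks -!const.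
split.
  apply: leq_trans (leq_addr _ _); apply: leq_sum => j _; apply: leq_sum => i _.
  apply: leq_bool => le1; rewrite -lerBrDr; apply: le_trans le1 _; rewrite lerD2l lerN2 mulrC ler_wpM2r ?ltW //.
  by apply: additive_fun_lt => //; apply: ltW.
apply: leq_add.
  apply: leq_sum => j _; apply: leq_sum => i _.
  apply: leq_bool => le1.
  apply: le_trans le1; rewrite lerDl mulr_ge0 //; first exact: ltW.
  by apply: additive_fun_ge0; apply: ltW.
(* The incomplete last block is bounded by its length. *)
apply: leq_trans (_ : (\sum_(2 ^ k * B <= i < N) 1 <= _)%N).
  by apply: leq_sum => i _; case: (_ <= _)%R.
rewrite sum_nat_const_nat muln1 leq_subLR.
have p0 : (0 < 2 ^ k)%N by rewrite expn_gt0.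
by have := ltn_pmod N p0; have := divn_eq N (2 ^ k); rewrite -/B mulnC; lia.
Qed.

Lemma empirical_df_dyadic (k N D : nat) (y : R) : (0 < N)%N ->
  (df_count beta (2 ^ k) y <= df_count beta (2 ^ k) (y - L * beta ^+ k) + D)%N ->
  `|empirical_df beta N y - empirical_df beta (2 ^ k) y| <=
    D%:R / (2 ^ k)%:R + (2 ^ k)%:R / N%:R.
Proof.
(* The claim multiplied by [p * N], with [p = 2 ^ k] and [N = B * p + s]; [a], [a'] are the block
   counts at [y] and at the shifted point, and the remainder [s] costs at most [p * p]. *)
have cross p B s a a' c : (B * a' <= c)%N -> (c <= B * a + p)%N -> (a <= a' + D)%N ->
    (a <= p)%N -> (s < p)%N ->
    (c * p <= a * (B * p + s) + (D * (B * p + s) + p * p))%N /\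
    (a * (B * p + s) <= c * p + (D * (B * p + s) + p * p))%N.
  move=> lo hi aD ap /ltnW sp; have := leq_mul hi (leqnn p); have := leq_mul lo (leqnn p).
  by have := leq_mul (leqnn (B * p)) aD; have := leq_mul ap sp; lia.
move=> N0 aD; have [lo hi] := df_count_blocks k N y.
have p0 : (0 < 2 ^ k)%N by rewrite expn_gt0.
have [] := cross _ _ _ _ _ _ lo hi aD (df_count_le _ beta _ _) (ltn_pmod N p0).
rewrite -divn_eq !empirical_dfE -!(ler_nat R) !natrD !natrM => h1 h2.
have pR : 0 < (2 ^ k)%:R :> R by rewrite ltr0n.
have NR : 0 < N%:R :> R by rewrite ltr0n.
move: (_ ^ k)%N pR (df_count _ N _) h1 h2 => p pR c h1 h2.
have -> : c%:R / N%:R - (df_count beta p y)%:R / p%:R =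
    (c%:R * p%:R - (df_count beta p y)%:R * N%:R) / (p%:R * N%:R) :> R.
  by field; rewrite !gt_eqF.
have -> : D%:R / p%:R + p%:R / N%:R = (D%:R * N%:R + p%:R * p%:R) / (p%:R * N%:R) :> R.
  by field; rewrite !gt_eqF.
rewrite normrM [X in _ * X]gtr0_norm ?invr_gt0 ?mulr_gt0 //.
rewrite ler_pM2r ?invr_gt0 ?mulr_gt0 // ler_norml; lra.
Qed.

End Blocks.

(** * Convergence and the rate with exponent [1 / (m + 1)] *)

Section Rate.
Context (R : realType) (beta : R) (m : nat).
Hypotheses (beta0 : 0 < beta) (beta1 : beta < 1) (m0 : (0 < m)%N) (bm : beta ^+ m <= 2^-1).
Local Notation L := ((1 - beta)^-1).
Let K := (Num.truncn L).+1.
Let p q := (2 ^ (m * q))%N.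

Lemma df_count_step (q : nat) (y : R) :
  (df_count beta (p q) y <= df_count beta (p q) (y - L * beta ^+ (m * q)) + K * 2 ^ (m.-1 * q))%N.
Proof.
set z := y - _.
have win := interleaved_count_le _ beta m q K
  (fun x => ((z < x) && (x <= z + L * (beta ^+ m) ^+ q))%R : nat) m0.
apply: leq_trans (_ : (_ <= df_count beta (p q) z + \sum_(0 <= r < p q)
   ((z < additive_fun beta r) && (additive_fun beta r <= z + L * (beta ^+ m) ^+ q))%R)%N) _.
  have -> : z + L * (beta ^+ m) ^+ q = y by rewrite -exprM subrK.
  rewrite /df_count -big_split; apply: leq_sum => i _; rewrite ltNge.
  by case: (additive_fun beta i <= y); case: (_ <= z).
rewrite leq_add2l; apply: win => t; apply: separated_count_le => //.
  by rewrite exprn_gt0.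
by rewrite invr_ge0 subr_ge0 ltW.
Qed.

(** Both errors of [empirical_df_dyadic] become multiples of [2 ^- q]: the window proportion is
    [K / 2 ^+ q], and the hypothesis on [N] gives [p q / N <= 2 ^- q]. *)
Lemma empirical_df_approx (q N : nat) (y : R) : (2 ^ (m.+1 * q) <= N)%N ->
  `|empirical_df beta N y - empirical_df beta (p q) y| <= K.+1%:R / 2 ^+ q.
Proof.
move=> qN; have N0 : (0 < N)%N by apply: leq_trans qN; rewrite expn_gt0.
apply: le_trans (empirical_df_dyadic _ _ _ beta1 _ _ _ _ N0 (df_count_step q y)) _ => //.
rewrite -[K.+1]addn1 natrD mulrDl; apply: lerD.
  rewrite -{2}(prednK m0) mulSn addnC expnD !natrM invfM natrX.
  by rewrite natrX mulrA mulfK // expf_neq0 // pnatr_eq0.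
rewrite mul1r ler_pdivrMr ?ltr0n // mulrC ler_pdivlMr ?exprn_gt0 //.
by rewrite -natrX -natrM ler_nat -expnD addnC -mulSn.
Qed.

Lemma is_cvg_empirical_df (y : R) : cvgn (fun N => empirical_df beta N y).
Proof.
apply: cauchy_cvg; apply: cauchy_exP => e e0.
have [q qe] : exists q, K.+1%:R / 2 ^+ q < e.
  exists (Num.truncn (K.+1%:R / e)); rewrite ltr_pdivrMr ?exprn_gt0 // mulrC -ltr_pdivrMr //.
  have /truncn_itv/andP[_ /lt_le_trans] : 0 <= K.+1%:R / e by rewrite divr_ge0 // ltW.
  by apply; rewrite -natrX ler_nat ltn_expl.
exists (empirical_df beta (p q) y).
change (\forall N \near \oo, ball (empirical_df beta (p q) y) e (empirical_df beta N y)).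
near=> N; have : (2 ^ (m.+1 * q) <= N)%N by near: N; exact: nbhs_infty_ge.
move=> /empirical_df_approx => /(_ y) le1.
by rewrite -ball_normE /= distrC; apply: le_lt_trans le1 qe.
Unshelve. all: by end_near.
Qed.

(** The previous bound is uniform in large [N], and convergence makes [limn] a true limit. *)
Lemma limit_df_approx (q : nat) (y : R) :
  `|limit_df beta y - empirical_df beta (p q) y| <= K.+1%:R / 2 ^+ q.
Proof.
rewrite ler_distl; apply/andP; split.
  apply: limr_ge; first exact: is_cvg_empirical_df.
  near=> N.
  have : (2 ^ (m.+1 * q) <= N)%N by near: N; exact: nbhs_infty_ge.
  by move/empirical_df_approx => /(_ y); rewrite ler_distl => /andP[].
apply: limr_le; first exact: is_cvg_empirical_df.
near=> N.
have : (2 ^ (m.+1 * q) <= N)%N by near: N; exact: nbhs_infty_ge.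
by move/empirical_df_approx => /(_ y); rewrite ler_distl => /andP[].
Unshelve. all: by end_near.
Qed.

Lemma limit_df_rate : exists2 C : R, 0 <= C & forall (N : nat) (y : R), (0 < N)%N ->
  `|limit_df beta y - empirical_df beta N y| <= C * N%:R `^ (- (m.+1%:R^-1)).
Proof.
(* One factor 2 comes from the triangle inequality through [p q], the other from replacing [2 ^- q]
   by [2 ^- q.+1]. *)
exists (4 * K.+1%:R) => [|N y N0]; first by rewrite mulr_ge0.
have m1 : (1 < 2 ^ m.+1)%N by rewrite -{1}(expn0 2) ltn_exp2l.
have /andP[] := trunc_log_bounds m1 N0.
(* The largest [q] with [2 ^ (m.+1 * q) <= N]; maximality bounds [2 ^- q.+1] by the power of [N]. *)
set q := trunc_log _ N; rewrite -!expnM => qN Nq.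
apply: le_trans (ler_distD (empirical_df beta (p q) y) _ _) _.
apply: le_trans (lerD (limit_df_approx q y) _) _.
  by rewrite distrC; apply: empirical_df_approx qN.
have : (2 ^+ q.+1)^-1 <= N%:R `^ (- (m.+1%:R^-1)) :> R.
  rewrite powRN lef_pV2 ?posrE ?powR_gt0 ?exprn_gt0 ?ltr0n //.
  apply: le_trans (_ : ((2 ^+ q.+1) `^ m.+1%:R) `^ (m.+1%:R^-1) <= _ :> R).
    apply: ge0_ler_powR; rewrite ?nnegrE ?ler0n ?powR_ge0 //.
    by rewrite powR_mulrn ?exprn_ge0 // -exprM -natrX ler_nat mulnC ltnW.
  by rewrite -powRrM mulfV // powRr1 // exprn_ge0.
rewrite exprS invfM => h.
have : K.+1%:R * (2^-1 / 2 ^+ q) <= K.+1%:R * N%:R `^ (- (m.+1%:R^-1)) :> R.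
  by rewrite ler_wpM2l.
lra.
Qed.

End Rate.

Lemma geometric_lt (R : realType) (c x e : R) : 0 <= x -> x < 1 -> 0 < e ->
  exists k, c * x ^+ k < e.
Proof.
move=> x0 x1 e0.
have : geometric c x @ \oo --> 0 by apply: cvg_geometric; rewrite ger0_norm.
move=> /(cvgr_lt _) /(_ e e0) [k _ hk].
by exists k; apply: hk => /=.
Qed.

(** * Failure of absolute continuity for [beta < 1/2] *)

Section Singular.
Context (R : realType) (beta : R).
Hypotheses (beta0 : 0 < beta) (beta2 : beta < 2^-1).
Local Notation L := ((1 - beta)^-1).

Let beta1 : beta < 1.
Proof. by apply: lt_trans beta2 _; rewrite invf_lt1 ?ltr1n. Qed.

(** Every [n >= 2 ^ k] has its value in the half-open interval attached to [i = n %% 2 ^ k]. For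
    [n < 2 ^ k] the value is the excluded left endpoint, hence the loss of [2 ^ k]. *)
Lemma df_count_sum_increments (k N : nat) :
  (\sum_(i < 2 ^ k) df_count beta N (additive_fun beta i) + (N - 2 ^ k) <=
   \sum_(i < 2 ^ k) df_count beta N (additive_fun beta i + L * beta ^+ k)%R)%N.
Proof.
have p0 : (0 < 2 ^ k)%N by rewrite expn_gt0.
pose hit (i n : nat) := (2 ^ k <= n)%N && (i == n %% 2 ^ k)%N.
apply: leq_trans (_ : (\sum_(i < 2 ^ k) (df_count beta N (additive_fun beta i) +
    \sum_(0 <= n < N) hit i n) <= _)%N).
  rewrite big_split leq_add2l exchange_big /=.
  apply: leq_trans (_ : (\sum_(2 ^ k <= n < N) 1 <= _)%N).
    by rewrite sum_nat_const_nat muln1.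
  have [Nk|kN] := leqP N (2 ^ k); first by rewrite big_geq.
  rewrite [leqRHS](big_cat_nat (leq0n _) (ltnW kN)) /=.
  apply: leq_trans (leq_addl _ _); rewrite big_nat_cond [leqRHS]big_nat_cond.
  apply: leq_sum => n /andP[/andP[kn _] _].
  rewrite (bigD1 (Ordinal (ltn_pmod n p0))) //= /hit kn eqxx.
  exact: leq_addr.
apply: leq_sum => i _; rewrite /df_count -big_split /=; apply: leq_sum => n _.
have [/andP[kn /eqP ein]|_] := boolP (hit i n); last first.
  rewrite addn0; apply: leq_bool => le1; apply: le_trans le1 _.
  by rewrite lerDl mulr_ge0 ?invr_ge0 ?subr_ge0 ?exprn_ge0 // ltW.
have fn : additive_fun beta n =
    additive_fun beta i + beta ^+ k * additive_fun beta (n %/ 2 ^ k).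
  by rewrite -additive_fun_block // ein addnC mulnC -divn_eq.
have -> : (additive_fun beta n <= additive_fun beta i + L * beta ^+ k)%R.
  rewrite fn lerD2l mulrC ler_wpM2r ?exprn_ge0 ?ltW //.
  by apply: additive_fun_lt => //; apply: ltW.
suff -> : (additive_fun beta n <= additive_fun beta i)%R = false by [].
apply/negbTE; rewrite -ltNge fn ltrDl mulr_gt0 ?exprn_gt0 //.
have nz : (n %/ 2 ^ k)%N <> 0%N by apply/eqP; rewrite -lt0n divn_gt0.
rewrite lt_def (additive_fun_ge0 _ _ (ltW beta0)) andbT; apply/eqP => f0.
(* Separation from the value at 0 shows that a nonzero quotient has a nonzero value. *)
have := additive_fun_gap _ _ _ _ _ (ltW beta0) (ltW beta2)
  (ltn_expl _ (isT : 1 < 2)%N) (expn_gt0 2 _) nz.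
by rewrite f0 additive_fun0 subrr normr0 mulr0 leNgt exprn_gt0.
Qed.

Lemma not_absolutely_continuous_limit_df : ~ absolutely_continuous (limit_df beta).
Proof.
move=> /(_ 2^-1) []; first by rewrite invr_gt0.
move=> d d0 ac.
have bb0 : 0 <= 2 * beta by rewrite mulr_ge0 // ltW.
have bb1 : 2 * beta < 1 by rewrite -ltr_pdivlMl // mulr1.
(* The [2 ^ k] intervals have total length [L * (2 * beta) ^+ k], which tends to 0. *)
have [k] := geometric_lt _ L (2 * beta) d bb0 bb1 d0.
rewrite exprMn mulrCA => kd.
have bm : beta ^+ 1 <= 2^-1 by rewrite expr1 ltW.
have h0 : 0 <= L * beta ^+ k.
  by rewrite mulr_ge0 ?invr_ge0 ?subr_ge0 ?exprn_ge0 // ltW.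
pose a (i : 'I_(2 ^ k)) := additive_fun beta i.
pose b i := a i + L * beta ^+ k.
have sum_lt : \sum_(i < 2 ^ k) `|limit_df beta (b i) - limit_df beta (a i)| < 2^-1.
  apply: ac.
  - by move=> i; rewrite lerDl.
  - move=> i j _ _ [x []]; rewrite /= !in_itv /= => /andP[ai bi] /andP[aj bj].
    apply/val_inj/eqP/negPn/negP => /eqP nij.
    (* Left endpoints are at least [L * beta ^+ k] apart, exactly the interval length. *)
    have := additive_fun_gap _ _ _ _ _ (ltW beta0) (ltW beta2) (ltn_ord i) (ltn_ord j) nij.
    rewrite -ler_pdivrMl ?subr_gt0 // leNgt => /negP; apply.
    by move: ai bi aj bj; rewrite /b /a ltr_norml; lra.
  - rewrite (eq_bigr (fun=> L * beta ^+ k)) => [|i _]; last by rewrite /b addrC addKr.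
    by rewrite sumr_const card_ord -mulr_natl natrX.
pose K := (Num.truncn L).+2%:R : R.
(* This [q] keeps the total loss below [1/2]: [2 ^ k] uncounted points, and an error [K / 2 ^ q] at
   both endpoints of each interval when [F] replaces [F_(2^q)]. *)
have [||| q] := geometric_lt _ ((2 ^ k)%:R * (1 + 2 * K)) 2^-1 2^-1.
- by rewrite invr_ge0.
- by rewrite invf_lt1 ?ltr1n.
- by rewrite invr_gt0.
rewrite exprVn -natrX => qK.
have q0 : 0 < (2 ^ q)%:R :> R by rewrite ltr0n expn_gt0.
have near y : `|limit_df beta y - empirical_df beta (2 ^ q) y| <= K / (2 ^ q)%:R.
  by have := limit_df_approx _ _ 1 beta0 beta1 isT bm q y; rewrite mul1n natrX.
have incr : 1 - (2 ^ k)%:R / (2 ^ q)%:R <=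
    \sum_(i < 2 ^ k) (empirical_df beta (2 ^ q) (b i) - empirical_df beta (2 ^ q) (a i)).
  have := df_count_sum_increments k (2 ^ q).
  rewrite -(ler_nat R) natrD !natr_sum => le1.
  have le2 : (2 ^ q)%:R - (2 ^ k)%:R <= (2 ^ q - 2 ^ k)%:R :> R.
    by rewrite lerBlDr -natrD ler_nat; lia.
  rewrite sumrB; under eq_bigr do rewrite empirical_dfE.
  under [X in _ <= _ - X]eq_bigr do rewrite empirical_dfE.
  rewrite -!mulr_suml -mulrBl ler_pdivlMr // mulrBl mul1r divfK ?gt_eqF //.
  lra.
have : \sum_(i < 2 ^ k) (empirical_df beta (2 ^ q) (b i) - empirical_df beta (2 ^ q) (a i)
    - 2 * (K / (2 ^ q)%:R)) <= \sum_(i < 2 ^ k) `|limit_df beta (b i) - limit_df beta (a i)|.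
  apply: ler_sum => i _; apply: le_trans (ler_norm _).
  have := near (a i); have := near (b i); rewrite !ler_distl => /andP[b1 b2] /andP[a1 a2].
  lra.
rewrite sumrB sumr_const card_ord -[X in _ - X]mulr_natl; lra.
Qed.

End Singular.

(** * Choice of [m], comparison of exponents, and conclusion *)

Lemma exists_exponent (R : realType) (beta : R) : 0 < beta -> beta < 1 ->
  exists m, [/\ (0 < m)%N, beta ^+ m <= 2^-1 & 2^-1 <= beta -> 2^-1 ^+ 2 <= beta ^+ m].
Proof.
move=> b0 b1; have h0 : 0 < 2^-1 :> R by rewrite invr_gt0.
have [k hk] := geometric_lt _ 1 beta 2^-1 (ltW b0) b1 h0.
have ex : exists m, beta ^+ m <= 2^-1 by exists k; rewrite mul1r in hk; apply: ltW.
(* For the least exponent the preceding power exceeds [1/2]; one more factor [beta >= 1/2] keeps it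
   above [1/4]. *)
case: (ex_minnP ex) => -[|m] bm min.
  by move: bm; rewrite expr0 leNgt invf_lt1 ?ltr1n.
exists m.+1; split => // b2; rewrite expr2 [leRHS]exprS.
apply: ler_pM; rewrite ?invr_ge0 // ltW // ltNge; apply/negP => /min.
by rewrite ltnn.
Qed.

(** With [t = ln beta^-1], the hypothesis reads [m * t <= 2 * ln 2] and the conclusion
    [(m + 1) * t <= 2 * ln 2 + t]. *)
Lemma exponent_le (R : realType) (beta : R) (m : nat) : 0 < beta -> beta < 1 ->
  2^-1 ^+ 2 <= beta ^+ m ->
  ln beta^-1 / (ln 2 + ln (2 / beta)) <= m.+1%:R^-1.
Proof.
move=> b0 b1 bm; have l2 : 0 < ln 2 :> R by rewrite ln_gt0 ?ltr1n.
have t0 : 0 < ln beta^-1 by rewrite ln_gt0 // invf_gt1.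
have -> : ln (2 / beta) = ln 2 + ln beta^-1 by rewrite lnM ?posrE ?invr_gt0.
have : ln (2^-1 ^+ 2) <= ln (beta ^+ m) by rewrite ler_ln ?posrE ?exprn_gt0 ?invr_gt0.
have lb : ln beta = - ln beta^-1 by rewrite lnV ?posrE // opprK.
rewrite !lnXn ?invr_gt0 // [ln 2^-1]lnV ?posrE // lb -[_ *+ m]mulr_natr => le1.
rewrite ler_pdivrMr; last by lra.
rewrite [leRHS]mulrC ler_pdivlMr ?ltr0n // -natr1.
lra.
Qed.

Lemma sup_norm_rate (R : realType) (beta C c a : R) : 0 <= C -> 0 <= a ->
  (forall N y, (0 < N)%N -> `|limit_df beta y - empirical_df beta N y| <= C * N%:R `^ (- c)) ->
  exists C' : R, forall N, (2 <= N)%N ->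
   (sup_norm (limit_df beta \- empirical_df beta N)%R
     <= (C' * N%:R `^ (- c) * ln N%:R `^ a)%:E)%E.
Proof.
move=> C0 a0 rate; have l2 : 0 < ln 2 :> R by rewrite ln_gt0 ?ltr1n.
(* Since [ln N >= ln 2], dividing by this power pays for the logarithmic factor. *)
exists (C / ln 2 `^ a) => N N2; apply: ge_ereal_sup => _ [y _ <-].
rewrite lee_fin; apply: le_trans (rate _ _ (ltnW N2)) _.
rewrite mulrAC ler_wpM2r ?powR_ge0 // mulrAC ler_pdivlMr ?powR_gt0 // ler_wpM2l //.
by apply: ge0_ler_powR => //; rewrite ?nnegrE ?ln_ge0 ?ler_ln ?posrE ?ltr0n ?ler_nat ?ler1n //; lia.
Qed.

Theorem theorem4 (R : realType) (beta : R) (hbeta0 : 0 < beta) (hbeta1 : beta < 1) :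
  (exists2 c : R, 0 < c &
    exists C : R, forall N : nat, (2 <= N)%N ->
      (sup_norm (limit_df beta \- empirical_df beta N)%R
        <= (C * N%:R `^ (- c) * ln N%:R `^ (ln beta^-1 / ln 2))%:E)%E)
  /\
  (absolutely_continuous (limit_df beta) ->
    exists C : R, forall N : nat, (2 <= N)%N ->
      (sup_norm (limit_df beta \- empirical_df beta N)%R
        <= (C * N%:R `^ (- (ln beta^-1 / (ln 2 + ln (2 / beta))))
              * ln N%:R `^ (ln beta^-1 / ln 2))%:E)%E).
Proof.
have [m [m0 bm bm4]] := exists_exponent _ _ hbeta0 hbeta1.
have [C C0 rate] := limit_df_rate _ _ _ hbeta0 hbeta1 m0 bm.
have a0 : 0 <= ln beta^-1 / ln 2.
  by rewrite divr_ge0 // ln_ge0 ?ler1n // invf_ge1 // ltW.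
split.
  exists (m.+1%:R^-1); first by rewrite invr_gt0.
  exact: (sup_norm_rate _ _ _ _ _ C0 a0 rate).
(* Absolute continuity forces [beta >= 1/2], so the exponent [1 / (m + 1)] is at least the one
   claimed. *)
move=> ac; have b2 : 2^-1 <= beta.
  by rewrite leNgt; apply/negP => b2; apply: (not_absolutely_continuous_limit_df _ _ hbeta0 b2).
apply: (sup_norm_rate _ _ _ _ _ C0 a0) => N y N0; apply: le_trans (rate N y N0) _.
apply: ler_wpM2l => //; apply: ler_powR; first by rewrite ler1n.
by rewrite lerN2; apply: exponent_le => //; apply: bm4.
Qed.
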